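(* Let $z>0$ and let $\gamma_n=\gamma_n(z)$ be the recurrence coefficients of the monic truncated Hermite polynomials $P_n(x;z)$, with $\gamma_0=0$. Then for all $n\ge 1$, $$\frac{z^{2}}{2}=\gamma_{n}\left(\gamma_{n-1}+\gamma_{n}-z^{2}+\frac{1}{2}-n\right)-\gamma_{n+1}\left(\gamma_{n+1}+\gamma_{n+2}-z^{2}-n-\frac{3}{2}\right).$$
   Context: For $z>0$ let $L[p]=\int_{-z}^{z}p(x)e^{-x^{2}}dx$, $p\in\mathbb{R}[x]$. The truncated Hermite polynomials $P_n(x;z)$, $n\ge0$, are the monic polynomials in $x$ with $\deg P_n=n$ and $L[P_kP_n]=h_n(z)\delta_{k,n}$, where $h_n(z)=L[P_n^2]>0$. They satisfy the three-term recurrence $xP_n(x;z)=P_{n+1}(x;z)+\gamma_n(z)P_{n-1}(x;z)$ with $P_{-1}=0$, $P_0=1$, where $\gamma_n(z)=h_n(z)/h_{n-1}(z)$ for $n\ge1$; convention: $\gamma_0=0$. *)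

(* Defs.v *)
From HB Require Import structures.
From mathcomp Require Import all_boot all_order all_algebra.
From mathcomp Require Import all_classical all_reals all_analysis.
Set Implicit Arguments.
Unset Strict Implicit.
Unset Printing Implicit Defensive.
Import Order.TTheory GRing.Theory Num.Theory.
Import numFieldNormedType.Exports.
Local Open Scope classical_set_scope.
Local Open Scope ring_scope.

Definition truncL (R : realType) (z : R) (p : {poly R}) : R :=
  \int[@lebesgue_measure R]_(x in `[- z, z]) (p.[x] * expR (- x ^+ 2)).

(* The orthogonality clause leaves [h_n = L[P_n ^ 2]] unconstrained on the
   diagonal: its positivity for [0 < z] is a consequence, not an assumption. *)
Definition trunc_hermite (R : realType) (z : R) (P : nat -> {poly R}) : Prop :=
  (forall n, P n \is monic /\ size (P n) = n.+1) /\
  (forall k n, k <> n -> truncL z (P k * P n) = 0).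

Definition hermite_h (R : realType) (z : R) (P : nat -> {poly R}) (n : nat) : R :=
  truncL z (P n ^+ 2).

Definition hermite_gamma (R : realType) (z : R) (P : nat -> {poly R})
    (n : nat) : R :=
  if n is m.+1 then hermite_h z P m.+1 / hermite_h z P m else 0.

(* Main.v *)
Require Import Defs.
From HB Require Import structures.
From mathcomp Require Import all_boot all_order all_algebra.
From mathcomp Require Import ring lra.
From mathcomp Require Import all_classical all_reals all_analysis.
Import Order.TTheory GRing.Theory Num.Theory.
Import numFieldNormedType.Exports.
Local Open Scope classical_set_scope.
Local Open Scope ring_scope.

(* The weight [w = exp (- x^2)] satisfies [w' = - 2 x w], so integration by
   parts gives [L[q'] = 2 L[x q]] for every polynomial [q] vanishing at [- z]
   and [z]. Taking [q = (x^2 - z^2) P_n P_(n-1)] and expanding with the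
   three-term recurrence yields
     [(n + 1) h_n + A_n - n z^2 h_(n-1)
        = 2 (h_(n+1) + g_n h_n + g_n g_(n-1) h_(n-1) - z^2 h_n)],
   where the only quantity not expressed by the [g]'s is
   [A_n = L[x^2 P_n' P_(n-1)]]. Differentiating the three-term recurrence gives
   [A_(n+1) = (n + 1) h_(n+1) + g_n (h_n + A_n - (n - 1) h_n)], which eliminates
   [A] between two consecutive instances of the identity. *)

(** * Integration against the Gaussian weight *)

Lemma is_derive_horner_gauss (R : realType) (q : {poly R}) (x : R) :
  is_derive x 1 (fun y => q.[y] * expR (- y ^+ 2))
    ((q^`() - (q * 'X) *+ 2).[x] * expR (- x ^+ 2)).
Proof.
have dq : is_derive x 1 (horner q) q^`().[x].
  by apply: DeriveDef; [exact: derivable_horner|rewrite derivE derive1E].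
apply: is_derive_eq => //.
rewrite !hornerE /= /GRing.scale /=; ring.
Qed.

Lemma continuous_horner_gauss (R : realType) (q : {poly R}) :
  continuous (fun y : R => q.[y] * expR (- y ^+ 2)).
Proof.
move=> x; apply: differentiable_continuous; apply/derivable1_diffP.
by have [] := is_derive_horner_gauss R q x.
Qed.

Lemma integrable_horner_gauss (R : realType) (z : R) (q : {poly R}) :
  (@lebesgue_measure R).-integrable `[- z, z]
    (EFin \o (fun x => q.[x] * expR (- x ^+ 2))).
Proof.
apply: continuous_compact_integrable; first exact: segment_compact.
exact/continuous_subspaceT/continuous_horner_gauss.
Qed.

Lemma truncLD (R : realType) (z : R) (p q : {poly R}) :
  truncL z (p + q) = truncL z p + truncL z q.
Proof.
rewrite /truncL -RintegralD//; [|exact: integrable_horner_gauss..].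
by apply: eq_Rintegral => x _; rewrite hornerD mulrDl.
Qed.

Lemma truncLZ (R : realType) (z c : R) (p : {poly R}) :
  truncL z (c *: p) = c * truncL z p.
Proof.
rewrite /truncL -RintegralZl//; last exact: integrable_horner_gauss.
by apply: eq_Rintegral => x _; rewrite hornerZ mulrA.
Qed.

(** The integrand is the derivative of [q.[y] * expR (- y ^+ 2)], so only boundary values remain;
    the weight is even, hence the common factor. *)
Lemma truncL_by_parts (R : realType) (z : R) (q : {poly R}) : 0 < z ->
  truncL z (q^`() - (q * 'X) *+ 2) = (q.[z] - q.[- z]) * expR (- z ^+ 2).
Proof.
move=> z0; rewrite /truncL /Rintegral.
rewrite (@continuous_FTC2 _ _ (fun y => q.[y] * expR (- y ^+ 2))).
- by rewrite sqrrN -EFinB /= mulrBl.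
- lra.
- exact/continuous_subspaceT/continuous_horner_gauss.
- split=> [x _||].
  + by have [] := is_derive_horner_gauss R q x.
  + exact/cvg_at_right_filter/continuous_horner_gauss.
  + exact/cvg_at_left_filter/continuous_horner_gauss.
- by move=> x _; have [_] := is_derive_horner_gauss R q x; rewrite derive1E.
Qed.

(** * Definiteness of the functional *)

Lemma finite_root (R : idomainType) (p : {poly R}) :
  p != 0 -> finite_set [set x | root p x].
Proof.
move=> p0; apply: contrapT => /(infinite_set_fset (size p))[B Bp].
apply/negP; rewrite -ltnNge; apply: max_poly_roots => //.
  by apply/allP => x xB; exact: Bp.
exact: finmap.fset_uniq.
Qed.

(** A nonnegative integrand with zero integral vanishes almost everywhere. For [p != 0] it vanishes
    only at the finitely many roots of [p], so the interval would be null, against its length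
    [2 * z]. *)
Lemma truncL_sqr_eq0 (R : realType) (z : R) (p : {poly R}) :
  0 < z -> truncL z (p * p) = 0 -> p = 0.
Proof.
move=> z0 Lp0; apply/eqP/negP => /negP p0.
have ip := integrable_horner_gauss R z (p * p).
have : (\int[@lebesgue_measure R]_(x in `[(- z)%R, z])
    `|((p * p).[x] * expR (- x ^+ 2))%R%:E|)%E = 0%E.
  transitivity (\int[@lebesgue_measure R]_(x in `[(- z)%R, z])
      ((p * p).[x] * expR (- x ^+ 2))%R%:E)%E.
    apply: eq_integral => x _; rewrite gee0_abs// lee_fin.
    by rewrite hornerM mulr_ge0 ?expR_ge0// -expr2 sqr_ge0.
  rewrite -[LHS]fineK; last exact: integrable_fin_num ip.
  by congr EFin.
move=> int0; have null_nz := proj1 (ae_eq_integral_abs lebesgue_measure (measurable_itv _)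
  (measurable_int _ ip)) int0.
have countable_roots : countable [set x | root p x].
  exact/finite_set_countable/finite_root.
have null_roots : (@lebesgue_measure R).-negligible [set x | root p x].
  exists [set x | root p x]; split => //.
  - exact: countable_measurable.
  - exact: countable_lebesgue_measure0.
have : (@lebesgue_measure R) `[- z, z]%classic = 0%E.
  apply: measure_negligible; first exact: measurable_itv.
  (* Each point of the interval is a root of [p] or a point where the integrand is nonzero; both
     sets are null. *)
  apply: (negligibleS _ (negligibleU null_nz null_roots)) => x xz.
  have [rx|rx] := boolP (root p x); [by right|left => /= /(_ xz) /eqP].
  by rewrite eqe hornerM !mulf_eq0 orbb -rootE (negbTE rx) gt_eqF// expR_gt0.
rewrite lebesgue_measure_itv /= lte_fin; have -> : - z < z by lra.
by rewrite -EFinB => -[]; lra.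
Qed.

(** * Linearity and parity of the functional *)

Lemma truncL_is_linear (R : realType) (z : R) : scalar (truncL z).
Proof. by move=> a p q; rewrite truncLD truncLZ. Qed.

HB.instance Definition _ (R : realType) (z : R) :=
  GRing.isLinear.Build R {poly R} R *%R (truncL z) (truncL_is_linear R z).

Lemma truncLCM (R : realType) (z c : R) (p : {poly R}) :
  truncL z (c%:P * p) = c * truncL z p.
Proof. by rewrite mul_polyC truncLZ. Qed.

(** Integration by parts on an even monomial has cancelling boundary values, which ties each odd
    moment to the preceding one; the constant [1] starts the induction. *)
Lemma truncL_odd_moment (R : realType) (z : R) (j : nat) : 0 < z ->
  truncL z 'X^(j.*2.+1) = 0.
Proof.
move=> z0; elim: j => [|j IHj].
  have := truncL_by_parts R z 1 z0.
  rewrite -polyC1 derivC sub0r !hornerC subrr mul0r mul1r linearN linearMn /=.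
  by rewrite -['X]expr1 => /eqP; rewrite oppr_eq0 mulrn_eq0 => /eqP.
have := truncL_by_parts R z 'X^(j.+1.*2) z0.
rewrite !hornerXn exprNn -signr_odd odd_double mul1r subrr mul0r derivXn -exprSr.
rewrite linearB !linearMn /= IHj mul0rn add0r => /eqP.
by rewrite mulrn_eq0 oppr_eq0 => /eqP.
Qed.

Lemma truncL_reflect (R : realType) (z : R) (p : {poly R}) : 0 < z ->
  truncL z (p \Po - 'X) = truncL z p.
Proof.
move=> z0; rewrite comp_polyE -[in RHS](coefK p) poly_def !linear_sum /=.
apply: eq_bigr => i _; rewrite !truncLZ exprNn -signr_odd.
case: (boolP (odd i)) => oi; last by rewrite expr0 mul1r.
by rewrite -(odd_double_half i) oi add1n expr1 mulN1r linearN /=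
  truncL_odd_moment// oppr0.
Qed.

(** * Consequences of orthogonality *)

Lemma monic_coef_size (R : nzRingType) (p : {poly R}) (n : nat) :
  p \is monic -> size p = n.+1 -> p`_n = 1.
Proof. by move=> /monicP; rewrite lead_coefE => <- ->. Qed.

(** The first [m] members of the family span the polynomials of size at most [m]. With [Q := D] this
    makes [D] orthogonal to itself, hence zero: the way polynomial identities are proved below. *)
Lemma trunc_hermite_span_orth (R : realType) (z : R) (P : nat -> {poly R})
    (hP : trunc_hermite z P) (D : {poly R}) (m : nat) :
  (forall k, (k < m)%N -> truncL z (D * P k) = 0) ->
  forall Q : {poly R}, (size Q <= m)%N -> truncL z (D * Q) = 0.
Proof.
have [monP _] := hP.
elim: m => [|m IHm] DP Q sQ.
  by move: sQ; rewrite leqn0 size_poly_eq0 => /eqP ->; rewrite mulr0 linear0.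
have -> : Q = (Q - Q`_m *: P m) + Q`_m *: P m by rewrite subrK.
rewrite mulrDr -scalerAr linearD /= truncLZ DP// mulr0 addr0.
apply: IHm => [k km|]; first by apply: DP; exact: ltnW.
have [monm sizem] := monP m.
apply/leq_sizeP => j; rewrite leq_eqVlt coefB coefZ => /predU1P[<-|mj].
  by rewrite (monic_coef_size _ _ _ monm sizem) mulr1 subrr.
by rewrite [Q`_j]nth_default ?(leq_trans sQ)// [(P m)`_j]nth_default
  ?sizem// mulr0 subr0.
Qed.

Lemma trunc_hermite_orth (R : realType) (z : R) (P : nat -> {poly R})
    (hP : trunc_hermite z P) (n : nat) (Q : {poly R}) :
  (size Q <= n)%N -> truncL z (P n * Q) = 0.
Proof.
apply: (trunc_hermite_span_orth _ _ _ hP) => k kn; have [_ ->//] := hP.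
by apply/eqP; rewrite gtn_eqF.
Qed.

(** Removing the multiple of [P n] with the same top coefficient leaves a polynomial orthogonal to
    [P n]. Most moments below reduce to reading off one coefficient in this way. *)
Lemma trunc_hermite_lead (R : realType) (z : R) (P : nat -> {poly R})
    (hP : trunc_hermite z P) (n : nat) (Q : {poly R}) :
  (size Q <= n.+1)%N -> truncL z (P n * Q) = Q`_n * hermite_h z P n.
Proof.
have [monn sizen] := hP.1 n => sQ.
have -> : Q = (Q - Q`_n *: P n) + Q`_n *: P n by rewrite subrK.
rewrite mulrDr -scalerAr linearD /= truncLZ (trunc_hermite_orth _ _ _ hP)//.
  by rewrite add0r subrK.
apply/leq_sizeP => j; rewrite leq_eqVlt coefB coefZ => /predU1P[<-|nj].
  by rewrite (monic_coef_size _ _ _ monn sizen) mulr1 subrr.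
by rewrite [Q`_j]nth_default ?(leq_trans sQ)// [(P n)`_j]nth_default
  ?sizen// mulr0 subr0.
Qed.

Lemma hermite_h_neq0 (R : realType) (z : R) (P : nat -> {poly R}) (n : nat) :
  0 < z -> trunc_hermite z P -> hermite_h z P n != 0.
Proof.
move=> z0 hP; apply/eqP => /(truncL_sqr_eq0 _ _ _ z0) Pn0.
by have [_] := hP.1 n; rewrite Pn0 size_poly0.
Qed.

(** * Parity and the three-term recurrence *)

Lemma trunc_hermite_reflect (R : realType) (z : R) (P : nat -> {poly R})
    (n : nat) : 0 < z -> trunc_hermite z P ->
  P n \Po - 'X = (- 1) ^+ n *: P n.
Proof.
move=> z0 hP; set S := P n \Po - 'X.
have [monn sizen] := hP.1 n.
have size_reflect (Q : {poly R}) : size (Q \Po - 'X) = size Q.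
  by rewrite size_comp_poly2// size_polyN size_polyX.
have coefS : S`_n = (- 1) ^+ n.
  have -> : n = (size S).-1 by rewrite size_reflect sizen.
  rewrite -lead_coefE lead_coef_comp ?size_polyN ?size_polyX// sizen.
  by rewrite (monicP monn) mul1r lead_coefN lead_coefX size_reflect sizen.
have reflectK (Q : {poly R}) : (Q \Po - 'X) \Po - 'X = Q.
  by rewrite -comp_polyA linearN /= comp_polyX opprK comp_polyXr.
have DP k : (k < n)%N -> truncL z ((S - (- 1) ^+ n *: P n) * P k) = 0.
  move=> kn; rewrite mulrBl -scalerAl linearB /= truncLZ.
  have [_ sizek] := hP.1 k.
  rewrite (trunc_hermite_orth _ _ _ hP) ?sizek// mulr0 subr0.
  (* Invariance of the functional moves the reflection from [P n] to [P k], whose size it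
     preserves. *)
  rewrite -(reflectK (P k)) -comp_polyM truncL_reflect//.
  by rewrite (trunc_hermite_orth _ _ _ hP)// size_reflect sizek.
apply/eqP; rewrite -subr_eq0; apply/eqP/(truncL_sqr_eq0 _ _ _ z0).
apply: (trunc_hermite_span_orth _ _ _ hP _ n) => //.
apply/leq_sizeP => j; rewrite leq_eqVlt coefB coefZ => /predU1P[<-|nj].
  by rewrite coefS (monic_coef_size _ _ _ monn sizen) mulr1 subrr.
by rewrite !nth_default ?size_reflect ?sizen// mulr0 subr0.
Qed.

(** Reflection turns this moment into its opposite. It is the reason why the recurrence has no
    diagonal term. *)
Lemma truncL_X_trunc_hermite_sqr (R : realType) (z : R)
    (P : nat -> {poly R}) (n : nat) : 0 < z -> trunc_hermite z P ->
  truncL z ('X * P n * P n) = 0.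
Proof.
move=> z0 hP; apply/eqP; rewrite -[_ == 0](@mulrn_eq0 R _ 2) mulr2n.
rewrite -[X in X + _]truncL_reflect// !comp_polyM comp_polyX.
rewrite (trunc_hermite_reflect _ _ _ _ z0 hP) -!(scalerAl, scalerAr).
by rewrite scalerA -expr2 sqrr_sign scale1r mulNr mulNr linearN addNr.
Qed.

Lemma hermite_gammaS (R : realType) (z : R) (P : nat -> {poly R}) (n : nat) :
  0 < z -> trunc_hermite z P ->
  hermite_h z P n.+1 = hermite_gamma z P n.+1 * hermite_h z P n.
Proof. by move=> z0 hP; rewrite /= divfK// hermite_h_neq0. Qed.

Lemma trunc_hermite_rec (R : realType) (z : R) (P : nat -> {poly R})
    (n : nat) : 0 < z -> trunc_hermite z P ->
  'X * P n = P n.+1 + (hermite_gamma z P n)%:P * P n.-1.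
Proof.
move=> z0 hP; set g := hermite_gamma z P n.
have sizeP k : size (P k) = k.+1 by have [] := hP.1 k.
have coefP k : (P k)`_k = 1.
  by have [] := hP.1 k; exact: monic_coef_size.
have sizeXP k : size ('X * P k) = k.+2.
  by rewrite mulrC size_mulX ?sizeP// -size_poly_eq0 sizeP.
apply/eqP; rewrite -subr_eq0; apply/eqP/(truncL_sqr_eq0 _ _ _ z0).
(* The difference of the two sides has degree at most [n], since the leading terms cancel; it
   remains to test it against [P k] for [k <= n], with [k = n] and [k = n.-1] treated apart. At
   [n = 0], where [n.-1] is [0], the coefficient [hermite_gamma z P 0 = 0] removes the extra
   term. *)
apply: (trunc_hermite_span_orth _ _ _ hP _ n.+1) => [k|].
  rewrite ltnS mulrBl mulrDl !linearB linearD /= => kn.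
  rewrite (trunc_hermite_orth _ _ _ hP) ?sizeP// add0r -[_%:P * _ * _]mulrA truncLCM.
  move: kn; rewrite leq_eqVlt => /predU1P[->|kn].
    rewrite truncL_X_trunc_hermite_sqr//.
    rewrite /g; case: n {g} => [|n]; first by rewrite mul0r subr0.
    by rewrite (hP.2 _ _ (n_Sn n)) mulr0 subr0.
  rewrite (mulrC 'X) -mulrA.
  move: kn; rewrite /g; case: n {g} => // n.
  rewrite ltnS leq_eqVlt => /predU1P[->|kn].
    rewrite (trunc_hermite_lead _ _ _ hP) ?sizeXP// coefXM /= coefP mul1r.
    rewrite -expr2 -[truncL z (P n ^+ 2)]/(hermite_h z P n).
    by rewrite divfK ?subrr ?hermite_h_neq0.
  by rewrite !(trunc_hermite_orth _ _ _ hP) ?sizeXP ?sizeP// mulr0 subr0.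
apply/leq_sizeP => j; rewrite leq_eqVlt coefB coefD coefCM => /predU1P[<-|nj].
  rewrite coefXM /= !coefP; case: n @g => [|n] g; first by rewrite mul0r addr0 subrr.
  by rewrite /= (nth_default _ (_ : _ <= _)%N) ?sizeP// mulr0 addr0 subrr.
rewrite !nth_default ?sizeXP ?sizeP//; last exact: leq_ltn_trans (leq_pred n) (ltnW nj).
by rewrite mulr0 addr0 subrr.
Qed.

(** * Moments entering the integration by parts *)

Lemma trunc_hermite_euler (R : realType) (z : R) (P : nat -> {poly R})
    (hP : trunc_hermite z P) (n : nat) :
  truncL z ('X * (P n)^`() * P n) = n%:R * hermite_h z P n.
Proof.
have [monn sizen] := hP.1 n.
rewrite mulrC (trunc_hermite_lead _ _ _ hP); last first.
  apply: leq_trans (size_polyMleq _ _) _.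
  by rewrite size_polyX /= ltnS -ltnS -sizen lt_size_deriv ?monic_neq0.
rewrite coefXM coef_deriv; case: n monn sizen => [|n] monn sizen /=.
  by rewrite !mul0r.
by rewrite (monic_coef_size _ _ _ monn sizen).
Qed.

(* The moment [L[X^2 P_(n+1)' P_n]] stands in for the coefficient of [X^(n-1)]
   in [P_(n+1)], which is thereby never needed. *)
Lemma trunc_hermite_X2_deriv_rec (R : realType) (z : R) (P : nat -> {poly R})
    (n : nat) : 0 < z -> trunc_hermite z P ->
  let g := hermite_gamma z P in let h := hermite_h z P in
  truncL z ('X^2 * (P n.+2)^`() * P n.+1) =
    n.+2%:R * h n.+2 +
    g n.+1 * (h n.+1 + truncL z ('X^2 * (P n.+1)^`() * P n) - n%:R * h n.+1).
Proof.
move=> z0 hP g h.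
have rec : 'X * P n.+1 = P n.+2 + (g n.+1)%:P * P n.
  exact: (trunc_hermite_rec _ _ _ n.+1 z0 hP).
have -> : 'X^2 * (P n.+2)^`() * P n.+1 =
    'X * (P n.+2)^`() * P n.+2 + (g n.+1)%:P * ('X * (P n.+2)^`() * P n).
  transitivity ('X * (P n.+2)^`() * ('X * P n.+1)); first by ring.
  by rewrite rec mulrDr [X in _ + X = _]mulrCA.
rewrite linearD /= truncLCM trunc_hermite_euler//; congr (_ + _ * _).
have -> : (P n.+2)^`() = P n.+1 + 'X * (P n.+1)^`() - (g n.+1)%:P * (P n)^`().
  have := congr1 (@deriv R) rec.
  by rewrite derivM derivX mul1r derivD derivM derivC mul0r add0r => ->; rewrite addrK.
have -> : 'X * (P n.+1 + 'X * (P n.+1)^`() - (g n.+1)%:P * (P n)^`()) * P n =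
    P n.+1 * ('X * P n) + 'X^2 * (P n.+1)^`() * P n
    - (g n.+1)%:P * ('X * (P n)^`() * P n).
  move: (g n.+1)%:P => c; ring.
have [monn sizen] := hP.1 n.
rewrite linearB linearD /= truncLCM trunc_hermite_euler//.
rewrite (trunc_hermite_lead _ _ _ hP); last first.
  by rewrite mulrC size_mulX ?sizen ?monic_neq0.
rewrite coefXM /= (monic_coef_size _ _ _ monn sizen) mul1r.
by congr (_ - _); rewrite mulrCA -hermite_gammaS.
Qed.

(** One factor of [('X * P n) * ('X * P n)] is expanded by the recurrence, and each resulting
    product is a leading-coefficient computation. *)
Lemma trunc_hermite_X2_sqr (R : realType) (z : R) (P : nat -> {poly R})
    (n : nat) : 0 < z -> trunc_hermite z P ->
  let g := hermite_gamma z P in let h := hermite_h z P in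
  truncL z ('X^2 * P n * P n) = h n.+1 + g n * h n.
Proof.
move=> z0 hP g h.
have rec := trunc_hermite_rec R z P n z0 hP.
have sizeP k : size (P k) = k.+1 by have [] := hP.1 k.
have coefP k : (P k)`_k = 1.
  by have [] := hP.1 k; exact: monic_coef_size.
have sizeXP k : size ('X * P k) = k.+2.
  by rewrite mulrC size_mulX ?sizeP// -size_poly_eq0 sizeP.
have -> : 'X^2 * P n * P n = ('X * P n) * ('X * P n) by ring.
rewrite {1}rec mulrDl linearD /= -[_%:P * _ * _]mulrA truncLCM.
rewrite (trunc_hermite_lead _ _ _ hP) ?sizeXP// coefXM /= coefP mul1r.
congr (_ + _); rewrite /g; case: n {rec} => [|n] /=; first by rewrite !mul0r.
have -> : P n * ('X * P n.+1) = P n.+1 * ('X * P n) by ring.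
rewrite (trunc_hermite_lead _ _ _ hP) ?sizeXP//.
by rewrite coefXM /= coefP mul1r.
Qed.

Lemma trunc_hermite_X3 (R : realType) (z : R) (P : nat -> {poly R})
    (n : nat) : 0 < z -> trunc_hermite z P ->
  let g := hermite_gamma z P in let h := hermite_h z P in
  truncL z ('X^3 * P n.+1 * P n) = h n.+2 + g n.+1 * (h n.+1 + g n * h n).
Proof.
move=> z0 hP g h.
have [monn sizen] := hP.1 n.
have sizeX2P : size (P n * 'X^2) = n.+3.
  by rewrite size_mulXn ?monic_neq0// sizen.
have rec : 'X * P n.+1 = P n.+2 + (g n.+1)%:P * P n.
  exact: (trunc_hermite_rec _ _ _ n.+1 z0 hP).
have -> : 'X^3 * P n.+1 * P n = ('X * P n.+1) * ('X^2 * P n) by ring.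
rewrite rec mulrDl linearD /= -[_%:P * _ * _]mulrA truncLCM.
rewrite [P n * _]mulrC trunc_hermite_X2_sqr// -/g -/h; congr (_ + _).
rewrite [_ * P n]mulrC (trunc_hermite_lead _ _ _ hP) ?sizeX2P// coefMXn /=.
by rewrite !subSS subn0 (monic_coef_size _ _ _ monn sizen) mul1r.
Qed.

(* Integration by parts applied to [(X^2 - z^2) P_(n+1) P_n], whose boundary
   term vanishes. *)
Lemma trunc_hermite_string (R : realType) (z : R) (P : nat -> {poly R})
    (n : nat) : 0 < z -> trunc_hermite z P ->
  let g := hermite_gamma z P in let h := hermite_h z P in
  n.+2%:R * h n.+1 + truncL z ('X^2 * (P n.+1)^`() * P n)
    - z ^+ 2 * n.+1%:R * h n =
  2 * (h n.+2 + g n.+1 * (h n.+1 + g n * h n) - z ^+ 2 * h n.+1).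
Proof.
move=> z0 hP g h; set a := g n.+1.
have sizeP k : size (P k) = k.+1 by have [] := hP.1 k.
have coefP k : (P k)`_k = 1.
  by have [] := hP.1 k; exact: monic_coef_size.
have nzP k : P k != 0 by rewrite -size_poly_eq0 sizeP.
have sizedP k : (size (P k)^`() <= k)%N.
  by rewrite -ltnS -(sizeP k) lt_size_deriv.
set w : {poly R} := 'X^2 - (z ^+ 2)%:P.
have := truncL_by_parts R z (w * (P n.+1 * P n)) z0.
have wz x : x ^+ 2 = z ^+ 2 -> (w * (P n.+1 * P n)).[x] = 0.
  by move=> xz; rewrite hornerM hornerD hornerN hornerXn hornerC xz subrr mul0r.
rewrite !wz ?sqrrN// subrr mul0r.
(* The terms are grouped so that each is either a moment named in the statement or already computed,
   or some [P k] times a polynomial of degree at most [k]. *)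
have -> : (w * (P n.+1 * P n))^`() - (w * (P n.+1 * P n) * 'X) *+ 2 =
    (P n.+1 * ('X * P n)) *+ 2 + 'X^2 * (P n.+1)^`() * P n
    - (z ^+ 2)%:P * (P n * (P n.+1)^`()) + P n.+1 * (P n)^`() * 'X^2
    - (z ^+ 2)%:P * (P n.+1 * (P n)^`())
    - ('X^3 * P n.+1 * P n - (z ^+ 2)%:P * (P n.+1 * ('X * P n))) *+ 2.
  rewrite !derivM derivB derivC derivXn /w; move: (z ^+ 2)%:P => c.
  rewrite /= expr1; ring.
rewrite !(linearB, linearD, linearMn) /= !truncLCM trunc_hermite_X3// -/g -/h -/a.
rewrite -[P n.+1 * _ * _]mulrA.
have XP : truncL z (P n.+1 * ('X * P n)) = h n.+1.
  rewrite (trunc_hermite_lead _ _ _ hP) ?coefXM ?coefP ?mul1r//.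
  by rewrite mulrC size_mulX ?sizeP.
have dP : truncL z (P n * (P n.+1)^`()) = n.+1%:R * h n.
  by rewrite (trunc_hermite_lead _ _ _ hP)// coef_deriv coefP.
have PdP : truncL z (P n.+1 * ((P n)^`() * 'X^2)) = n%:R * h n.+1.
  rewrite (trunc_hermite_lead _ _ _ hP).
    rewrite coefMXn ltnS subSS subn1 coef_deriv.
    (* At [n = 0] the shift by ['X^2] makes the coefficient [0], in agreement with the factor
       [n%:R]. *)
    by case: (posnP n) => [->|n0]; rewrite ?mul0r// ltnNge n0 prednK// coefP.
  rewrite (leq_trans (size_polyMleq _ _))// size_polyXn addn3 /= !ltnS.
  exact: sizedP.
have PdP0 : truncL z (P n.+1 * (P n)^`()) = 0.
  by rewrite (trunc_hermite_orth _ _ _ hP)// ltnW// ltnS sizedP.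
rewrite XP dP PdP PdP0 -[n.+2%:R]natr1 -[n.+1%:R]natr1; lra.
Qed.

(** * Elimination of the derivative moment *)

Theorem theorem9 (R : realType) (z : R) (P : nat -> {poly R})
    (hz : 0 < z) (hP : trunc_hermite z P) (n : nat) (hn : (1 <= n)%N) :
  let g := hermite_gamma z P in
  z ^+ 2 / 2 =
    g n * (g n.-1 + g n - z ^+ 2 + 1 / 2 - n%:R)
    - g n.+1 * (g n.+1 + g n.+2 - z ^+ 2 - n%:R - 3 / 2).
Proof.
move: n hn => [//|n] _ g; rewrite [n.+1.-1]/=.
have h0 : hermite_h z P n.+1 != 0 by exact: hermite_h_neq0.
have hE k := hermite_gammaS R z P k hz hP.
have := trunc_hermite_string R z P n hz hP.
have := trunc_hermite_string R z P n.+1 hz hP.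
have := trunc_hermite_X2_deriv_rec R z P n hz hP.
lazy zeta; rewrite -/g; set A := truncL z _; set B := truncL z _.
have := hE n; have := hE n.+1; have := hE n.+2; rewrite -/g in h0 *.
move: A B (hermite_h z P n) (hermite_h z P n.+1) h0 (hermite_h z P n.+2)
  (hermite_h z P n.+3) => A B h_0 h_1 h10 h_2 h_3.
move: (g n) (g n.+1) (g n.+2) (g n.+3) => g0 g1 g2 g3.
rewrite -[n.+3%:R]natr1 -[n.+2%:R]natr1 -[n.+1%:R]natr1; move: n%:R => N.
move=> E3 E2 E1 EA EB EC.
(* The identity is proved after multiplication by the nonzero [h_1]. Scaling [EC] by [g1] gives [B]
   the same coefficient as in [EB] once [A] is replaced through [EA], so [B] cancels in their
   difference. *)
apply: (mulfI h10).
have {}EC := congr1 (GRing.mul g1) EC.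
subst A h_3 h_2 h_1; lra.
Qed.
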